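(* For type $C$, let $P_0=\emptyset$, $P_1=\{1\}$ and, for $r\ge 2$, let $P_r$ be the set of all elements of the Weyl alternation set $\mathcal C_r=\{\sigma\in W_r:\wp(\sigma(\tilde\alpha+\rho)-\rho)>0\}$ of the Lie algebra of type $C_r$ which do not contain a factor of $s_r$. Then the cardinality of $P_r$ is given by the recursive formula \[|P_r|=|P_{r-1}|+|P_{r-2}|+3|P_{r-3}|+|P_{r-4}|\qquad (r\ge 4),\] where $|P_0|=0$, $|P_1|=|P_2|=1$, $|P_3|=2$.
   Context: Type $C_r$ ($\mathfrak{sp}_{2r}(\mathbb C)$, $r\ge 2$): simple roots $\alpha_i=\varepsilon_i-\varepsilon_{i+1}$ for $1\le i\le r-1$ and $\alpha_r=2\varepsilon_r$; positive roots $\Phi^+=\{\varepsilon_i-\varepsilon_j,\varepsilon_i+\varepsilon_j:1\le i<j\le r\}\cup\{2\varepsilon_i:1\le i\le r\}$; highest root $\tilde\alpha=2\alpha_1+2\alpha_2+\cdots+2\alpha_{r-1}+\alpha_r$ $(=2\varepsilon_1)$; $\rho=\frac12\sum_{\alpha\in\Phi^+}\alpha$. $s_i$ denotes the simple reflection in $\alpha_i$, and $W_r$ is the Weyl group generated by $s_1,\dots,s_r$. $\wp(\xi)$ is Kostant's partition function: the number of ways $\xi$ may be written as a nonnegative integral sum of positive roots. An element of $W_r$ contains a factor of $s_r$ if $s_r$ occurs in a (equivalently, every) reduced expression for it. The paper computes $P_2=\{1\}$ and $P_3=\{1,s_2\}$. *)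

(* Defs.v *)
From HB Require Import structures.
From mathcomp Require Import all_boot all_order all_algebra finmap.
From mathcomp Require Import mathcomp_extra boolp classical_sets functions.
From mathcomp Require Import cardinality.
From mathcomp Require Import ring.

Set Implicit Arguments.
Unset Strict Implicit.
Unset Printing Implicit Defensive.

Import Order.TTheory GRing.Theory Num.Theory.
Local Open Scope ring_scope.
Local Open Scope classical_set_scope.

(* Weights of sp_{2r} are column vectors in the epsilon-coordinates.  All the
   weights involved are rational, so Q^r replaces the dual of the Cartan
   subalgebra.  Indices are 0-based: [eps r k] is epsilon_{k+1}. *)
Definition eps (r k : nat) : 'cV[rat]_r := \col_(i < r) ((i : nat) == k)%:R.

(* [simple_root i] is alpha_{i+1}; the last index gives the long root. *)
Definition simple_root (r : nat) (i : 'I_r) : 'cV[rat]_r :=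
  if i.+1 == r then 2 *: eps r i else eps r i - eps r i.+1.

Definition pos_roots (r : nat) : seq 'cV[rat]_r :=
  [seq eps r i - eps r j | i : 'I_r <- enum 'I_r,
                           j : 'I_r <- [seq j : 'I_r <- enum 'I_r | (i < j)%N]]
  ++ [seq eps r i + eps r j | i : 'I_r <- enum 'I_r,
                           j : 'I_r <- [seq j : 'I_r <- enum 'I_r | (i < j)%N]]
  ++ [seq 2 *: eps r i | i : 'I_r <- enum 'I_r].

Definition pos_root (r : nat) : finType := seq_sub (pos_roots r).

Definition highest_root (r : nat) : 'cV[rat]_r :=
  \sum_(i < r) (if i.+1 == r then 1 else 2) *: simple_root i.

Definition rho (r : nat) : 'cV[rat]_r :=
  2^-1 *: \sum_(a : pos_root r) ssval a.

(* The orthogonal reflection v |-> v - 2 (v, a) / (a, a) a. *)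
Definition reflection (r : nat) (a : 'cV[rat]_r) : 'M[rat]_r :=
  1%:M - (2 / (a^T *m a) 0 0) *: (a *m a^T).

Definition simple_refl (r : nat) (i : 'I_r) : 'M[rat]_r :=
  reflection (simple_root i).

Definition word_prod (r : nat) (w : seq 'I_r) : 'M[rat]_r :=
  \big[mulmx/1%:M]_(i <- w) simple_refl i.

(* The simple reflections are involutions, so the group they generate consists
   of the products of words in them. *)
Definition weyl_group (r : nat) : set 'M[rat]_r :=
  [set sigma | exists w : seq 'I_r, word_prod w = sigma].
Arguments weyl_group : clear implicits.

Definition reduced_expr (r : nat) (sigma : 'M[rat]_r) (w : seq 'I_r) : Prop :=
  word_prod w = sigma /\
  forall w' : seq 'I_r, word_prod w' = sigma -> (size w <= size w')%N.

Definition has_last_factor (r : nat) (sigma : 'M[rat]_r) : Prop :=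
  exists w : seq 'I_r,
    reduced_expr sigma w /\ exists2 i : 'I_r, i \in w & i.+1 = r.

Definition root_decomp (r : nat) (xi : 'cV[rat]_r) :
    set {ffun pos_root r -> nat} :=
  [set m | \sum_(a : pos_root r) ssval a *+ m a = xi].

(* [fset_set] of an infinite set is empty; [finite_root_decomp] and [finite_P]
   below show that this case does not occur. *)
Definition kostant (r : nat) (xi : 'cV[rat]_r) : nat :=
  #|` fset_set (root_decomp xi)|.

Definition weyl_alt_set (r : nat) : set 'M[rat]_r :=
  [set sigma | weyl_group r sigma /\
    (0 < kostant (sigma *m (highest_root r + rho r) - rho r))%N].
Arguments weyl_alt_set : clear implicits.

(* The ranks 0 and 1 are conventions. *)
Definition P (r : nat) : set 'M[rat]_r :=
  match r with
  | 0 => set0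
  | 1 => [set 1%:M]
  | r'.+2 => [set sigma | weyl_alt_set r'.+2 sigma /\ ~ has_last_factor sigma]
  end.
Arguments P : clear implicits.

Definition card_P (r : nat) : nat := #|` fset_set (P r)|.

Lemma pos_root_height (r : nat) (a : pos_root r) :
  1 <= \sum_(k < r) (r - k)%:R * ssval a k 0.
Proof.
have height_eps (i : 'I_r) : \sum_(k < r) (r - k)%:R * eps r i k 0 = (r - i)%:R.
  rewrite (bigD1 i) //= mxE eqxx mulr1 big1 ?addr0 // => k ki.
  by rewrite mxE (_ : (k : nat) == i = false) ?mulr0 //; apply/negbTE.
have := ssvalP a; rewrite !mem_cat => /or3P[/allpairsPdep|/allpairsPdep|/mapP].
- move=> [i [j [_]]]; rewrite mem_filter => /andP[ij _] ->.
  under eq_bigr do rewrite !mxE mulrBr.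
  rewrite sumrB; have /= := height_eps i; have /= := height_eps j.
  under eq_bigr do rewrite mxE.
  move=> ->; under eq_bigr do rewrite mxE.
  move=> ->; rewrite lerBrDr -[1]/(1%:R) -natrD ler_nat.
  by rewrite add1n ltn_sub2l.
- move=> [i [j [_ _ ->]]].
  under eq_bigr do rewrite !mxE mulrDr.
  rewrite big_split; have /= := height_eps i; have /= := height_eps j.
  under eq_bigr do rewrite mxE.
  move=> ->; under eq_bigr do rewrite mxE.
  move=> ->; rewrite -natrD -[1]/(1%:R) ler_nat.
  by rewrite addn_gt0 subn_gt0 ltn_ord.
- move=> [i _ ->]; under eq_bigr do rewrite mxE mulrCA.
  rewrite -mulr_sumr height_eps -natrM -[1]/(1%:R) ler_nat.
  by rewrite muln_gt0 subn_gt0 ltn_ord.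
Qed.

Lemma finite_root_decomp (r : nat) (xi : 'cV[rat]_r) :
  finite_set (root_decomp xi).
Proof.
pose h (v : 'cV[rat]_r) := \sum_(k < r) (r - k)%:R * v k 0.
have [N hN] : exists N : nat, h xi <= N%:R.
  exists (Num.truncn `|h xi|).+1; rewrite (le_trans (ler_norm _)) //.
  by rewrite ltW // truncnS_gt.
apply: (@sub_finite_set _ _
  ((fun f : {ffun pos_root r -> 'I_N.+1} => [ffun a => f a : nat]) @` setT)).
  move=> m /= mE.
  have hm : h xi = \sum_a h (ssval a) *+ m a.
    rewrite /h -mE; under eq_bigr do rewrite summxE mulr_sumr.
    rewrite exchange_big; apply: eq_bigr => a _.
    rewrite -sumrMnl; apply: eq_bigr => k _.
    by rewrite mulmxnE mulrnAr.
  have mN a : (m a < N.+1)%N.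
    rewrite ltnS -(ler_nat rat); apply: le_trans hN; rewrite hm (bigD1 a) //=.
    have h1 (b : pos_root r) : 1 <= h (ssval b) by exact: pos_root_height.
    apply: (@le_trans _ _ (h (ssval a) *+ m a)).
      by rewrite lerMn2r h1 orbT.
    rewrite lerDl sumr_ge0 // => b _.
    by rewrite mulrn_wge0 // (le_trans ler01).
  exists [ffun a => Ordinal (mN a)] => //=.
  by apply/ffunP => a; rewrite !ffunE.
by apply: finite_image; exact: finite_finset.
Qed.

Lemma finite_weyl_group (r : nat) : finite_set (weyl_group r).
Proof.
pose signed (s : 'M[rat]_r) := forall (A : 'M[rat]_r) i,
  exists k, exists b : bool, forall j, (s *m A) i j = (-1) ^+ b * A k j.
have signed_refl (i : 'I_r) : signed (simple_refl i).
  have epsM n (k : 'I_r) (B : 'M[rat]_(r, n)) j :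
      ((eps r k)^T *m B) 0 j = B k j.
    rewrite mxE (bigD1 k) //= !mxE eqxx mul1r big1 ?addr0 // => l lk.
    by rewrite !mxE (_ : (l : nat) == k = false) ?mul0r //; apply/negbTE.
  have reflE (a : 'cV[rat]_r) A p j : (reflection a *m A) p j
      = A p j - 2 / (a^T *m a) 0 0 * (a p 0 * (a^T *m A) 0 j).
    rewrite /reflection mulmxBl mul1mx -scalemxAl -mulmxA [LHS]mxE; congr (_ + _).
    by rewrite !mxE big_ord1 [in LHS]mxE.
  move=> A p; rewrite /simple_refl /simple_root; case: ifPn => ir.
    have aM n (B : 'M[rat]_(r, n)) j : ((2 *: eps r i)^T *m B) 0 j = 2 * B i j.
      by rewrite linearZ /= -scalemxAl mxE epsM.
    case: (eqVneq p i) => [->|pi].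
      exists i, true => j; rewrite reflE !aM !mxE eqxx.
      by rewrite mulr1 expr1; field.
    exists p, false => j; rewrite reflE !aM !mxE.
    by rewrite (negbTE pi : (p : nat) == i = false) eqxx /=; field.
  have i1r : (i.+1 < r)%N by rewrite ltn_neqAle ir ltn_ord.
  pose k := Ordinal i1r; rewrite (_ : i.+1 = k) //.
  have ki : (k : nat) == i = false by rewrite /= gtn_eqF.
  have aM n (B : 'M[rat]_(r, n)) j :
      ((eps r i - eps r k)^T *m B) 0 j = B i j - B k j.
    rewrite linearB mulmxBl mxE epsM; congr (_ + _).
    by rewrite mxE epsM.
  have ik : (i : nat) == k = false by rewrite eq_sym.
  case: (eqVneq p i) => [->|pi].
    exists k, false => j.
    by rewrite reflE !aM !mxE !eqxx ik ki /=; field.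
  case: (eqVneq p k) => [->|pk].
    exists i, false => j.
    by rewrite reflE !aM !mxE !eqxx ik ki /=; field.
  exists p, false => j; rewrite reflE !aM !mxE !eqxx ik ki.
  by rewrite (negbTE pi : (p : nat) == i = false)
             (negbTE pk : (p : nat) == k = false) /=; field.
pose val3 (c : 'I_3) : rat := (c : nat)%:R - 1.
have entries (w : seq 'I_r) i j : exists c, word_prod w i j = val3 c.
  elim: w i j => [|s w IHw] i j.
    rewrite /word_prod big_nil mxE; case: eqP => _ /=.
      by exists (inord 2); rewrite /val3 inordK.
    by exists (inord 1); rewrite /val3 inordK.
  rewrite /word_prod big_cons.
  have [k [b ->]] := signed_refl s (word_prod w) i.
  have [c ->] := IHw k j; case: b; last by exists c; rewrite expr0 mul1r.
  exists (rev_ord c); rewrite /val3 /= expr1 mulN1r.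
  by rewrite natrB ?leq_ord // -[3%N]/(2 + 1)%N; case: c => [[|[|[|]]]].
apply: (@sub_finite_set _ _
  ((fun f : {ffun 'I_r * 'I_r -> 'I_3} => \matrix_(i, j) val3 (f (i, j)))
     @` setT)).
  move=> _ [w <-] /=.
  have [f fE] := choice (fun p => entries w p.1 p.2).
  exists (finfun f) => //; apply/matrixP => i j.
  by rewrite mxE ffunE -fE.
by apply: finite_image; exact: finite_finset.
Qed.

Lemma finite_P (r : nat) : finite_set (P r).
Proof.
case: r => [|[|r]] /=; [exact: finite_set0|exact: finite_set1|].
by apply: sub_finite_set (finite_weyl_group r.+2) => sigma [[]].
Qed.

(* Main.v *)
Require Import Defs.
From mathcomp Require Import all_boot.
From mathcomp Require Import all_order all_fingroup all_algebra finmap.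
From mathcomp Require Import boolp classical_sets cardinality.
From mathcomp Require Import ring lra zify.

(** The Weyl group of type C acts on the epsilon-coordinates by signed
    permutations, and forgetting the signs is a homomorphism that sends s_r to
    the identity.  Hence s_r can be deleted from any word for an unsigned
    permutation, and the elements without a factor of s_r are exactly the
    permutation matrices ([no_last_factorP]).

    In coordinates rho = (r, r - 1, ..., 1) and the highest root is 2 eps_1, so
    sigma permutes the entries of (r + 2, r - 1, ..., 1) and rho is then
    subtracted.  A vector with integer coordinates is a nonnegative integral
    sum of positive roots exactly when its partial sums are nonnegative and its
    total is even ([kostant_partial_sum], [kostant_gt0_of_partial_sums]); here
    the total is always 2.  So |P_r| counts the orderings of
    r + 2, r - 1, ..., 1 whose partial sums dominate those of r, r - 1, ..., 1.
    The entry r + 2 must come first and gives a surplus of 2; what remains is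
    the number f(n) of orderings of n, ..., 1, with n = r - 1, whose partial
    sums never fall more than 2 below those of n, ..., 1 itself ([feasible],
    [card_P_feasible]).

    Cut such an ordering at the first moment when its deficit returns to zero:
    the block before the cut rearranges an initial segment of n, ..., 1, and
    the budget 2 only allows indecomposable blocks of length at most 4, namely
    1, 1, 3 and 1 of them of lengths 1, 2, 3 and 4.  This gives
    f(n) = f(n-1) + f(n-2) + 3 f(n-3) + f(n-4) for n >= 4.  For n = 3, that is
    r = 4, the last term is absent, in accordance with |P_0| = 0.  The formal proof follows the
    same blocks entry by entry: at each moment at most three entries can come
    next ([orderings_cat_countdown]), and only a few shapes of the remaining
    list occur ([feasible_first], [orderings_skip_second],
    [orderings_skip_third], [orderings_two_ahead]). *)

Set Implicit Arguments.
Unset Strict Implicit.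
Unset Printing Implicit Defensive.

Import Order.TTheory GRing.Theory Num.Theory.

(** * Orderings respecting a budget *)

(** The targets size t, size t - 1, ..., 1 are subtracted from the successive
    entries of t, starting from a balance b that must never become negative.
    The target at each step is the number of entries still to be placed, so
    that no separate list of targets has to be carried along. *)
Fixpoint within_budget (b : nat) (t : seq nat) : bool :=
  if t is x :: t' then (size t <= b + x) && within_budget (b + x - size t) t'
  else true.

Lemma within_budgetP b t :
  reflect (forall k, k <= size t ->
             \sum_(i < k) (size t - i) <= b + \sum_(i < k) nth 0 t i)
          (within_budget b t).
Proof.
have sumS t' k : \sum_(i < k.+1) ((size t').+1 - i)
               = (size t').+1 + \sum_(i < k) (size t' - i).
  by rewrite big_ord_recl subn0; under eq_bigr do rewrite lift0 subSS.
have nthS x t' k : \sum_(i < k.+1) nth 0 (x :: t') i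
                 = x + \sum_(i < k) nth 0 t' i.
  by rewrite big_ord_recl.
elim: t b => [|x t IHt] b.
  by left => -[|//]; rewrite !big_ord0.
apply: (iffP andP) => [[le_x /IHt ht] [|k] lek|ht].
- by rewrite !big_ord0.
- by rewrite sumS nthS; move: (ht k lek) le_x => /=; lia.
have le_x : size (x :: t) <= b + x.
  by have := ht 1 isT; rewrite sumS nthS !big_ord0 /=; lia.
split=> //; apply/IHt => k lek.
by have := ht k.+1 lek; rewrite sumS nthS; move: le_x => /=; lia.
Qed.

Definition orderings (b : nat) (L : seq nat) : nat :=
  count (within_budget b) (permutations L).

Lemma orderings_cons b (L : seq nat) : 0 < size L -> uniq L ->
  orderings b L = \sum_(x <- L | size L <= b + x)
                    orderings (b + x - size L) (rem x L).
Proof.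
move=> L0 uL; rewrite /orderings (seq.permP (permutationsE L0)) undup_id //.
rewrite count_flatten -map_comp sumnE big_map [RHS]big_mkcond /=.
apply: eq_big_seq => x xL; rewrite count_map.
have szt t : t \in permutations (rem x L) -> (size t).+1 = size L.
  by rewrite mem_permutations => /perm_size ->; rewrite size_rem // prednK.
case: ifP => [le_x|nle_x].
  by apply: eq_in_count => t /szt /= ->; rewrite le_x.
rewrite (eq_in_count (a2 := pred0)) ?count_pred0 // => t /szt /= ->.
by rewrite nle_x.
Qed.

Definition countdown (n : nat) : seq nat := rev (iota 1 n).

Lemma countdownS n : countdown n.+1 = n.+1 :: countdown n.
Proof. by rewrite /countdown -[X in iota 1 X]addn1 iotaD rev_cat add1n. Qed.

Lemma size_countdown n : size (countdown n) = n.
Proof. by rewrite size_rev size_iota. Qed.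

Lemma mem_countdown n x : (x \in countdown n) = (0 < x <= n).
Proof. by rewrite mem_rev mem_iota add1n ltnS. Qed.

Lemma uniq_countdown n : uniq (countdown n).
Proof. by rewrite rev_uniq iota_uniq. Qed.

Lemma nth_countdown n i : (i < n)%N -> nth 0%N (countdown n) i = (n - i)%N.
Proof. by move=> i_n; rewrite nth_rev ?size_iota // nth_iota; lia. Qed.

Lemma rem_cat_l (T : eqType) (x : T) s1 s2 :
  x \in s1 -> rem x (s1 ++ s2) = rem x s1 ++ s2.
Proof.
elim: s1 => //= y s1 IHs; rewrite inE eq_sym.
by case: eqVneq => //= _ /IHs ->.
Qed.

(** The first target is size L + n, and an entry of the countdown misses it by
    at least size L > b: only the entries of L can come first. *)
Lemma orderings_cat_countdown b (L : seq nat) n :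
    b < size L -> uniq L -> all (fun x => n < x) L ->
  orderings b (L ++ countdown n) =
  \sum_(x <- L | size L + n <= b + x)
     orderings (b + x - (size L + n)) (rem x L ++ countdown n).
Proof.
move=> bL uL /allP gtL; have szE : size (L ++ countdown n) = size L + n.
  by rewrite size_cat size_countdown.
rewrite orderings_cons; first last.
- rewrite cat_uniq uL uniq_countdown andbT /=; apply/hasPn => x.
  by rewrite mem_countdown => xn; apply/negP => /gtL; lia.
- by rewrite szE; lia.
rewrite szE big_cat /= [X in _ + X]big1_seq ?addn0; last first.
  by move=> x; rewrite mem_countdown; lia.
rewrite big_seq_cond [RHS]big_seq_cond; apply: eq_bigr => x /andP[xL _].
by rewrite rem_cat_l.
Qed.

(** These numbers satisfy the recursion of the theorem: the first, forced, entry
    r + 2 of the orderings to be counted exceeds its target r by 2. *)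
Definition feasible (n : nat) : nat := orderings 2 (countdown n).

(** The surplus of the large entry over its target n + 1 restores the full
    budget 2, so the process starts afresh on the remaining entries. *)
Lemma orderings_two_ahead n : orderings 0 (n.+3 :: countdown n) = feasible n.
Proof.
rewrite (@orderings_cat_countdown 0 [:: n.+3] n) //=; last by rewrite andbT; lia.
rewrite big_mkcond big_seq1 /= eqxx ifT; last lia.
by congr orderings; lia.
Qed.

(** This situation arises when n + 2, the second largest entry, was placed
    first at the cost of 1. *)
Lemma orderings_skip_second n :
  orderings 1 [:: n.+3, n.+1 & countdown n] = feasible n.+1 + feasible n.
Proof.
rewrite (@orderings_cat_countdown 1 [:: n.+3; n.+1] n) //=; first last.
- by rewrite andbT; lia.
- by rewrite inE; lia.
rewrite big_mkcond !big_cons big_nil /= !eqxx /= -countdownS addn0.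
rewrite (_ : (n.+3 == n.+1) = false); last lia.
rewrite !ifT /=; [ | lia | lia].
rewrite -(orderings_two_ahead n) /feasible.
by congr (orderings _ _ + orderings _ _); lia.
Qed.

(** With budget 2 the first entry is the largest, the second or the third. *)
Lemma feasible_first n :
  feasible n.+3 = feasible n.+2 + orderings 1 [:: n.+3, n.+1 & countdown n]
                  + orderings 0 [:: n.+3, n.+2 & countdown n].
Proof.
rewrite {1}/feasible 3!countdownS.
rewrite (@orderings_cat_countdown 2 [:: n.+3; n.+2; n.+1] n) //=; first last.
- by rewrite andbT; lia.
- by rewrite !inE; lia.
rewrite big_mkcond !big_cons big_nil /= !eqxx.
have [-> -> ->] :
    [/\ n.+3 == n.+2 = false, n.+3 == n.+1 = false & n.+2 == n.+1 = false].
  by split; lia.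
rewrite addn0 addnA /=; congr (_ + _ + _).
- by rewrite ifT -?countdownS -?countdownS; [congr orderings | ]; lia.
- by rewrite ifT; [congr orderings | ]; lia.
- by rewrite ifT; [congr orderings | ]; lia.
Qed.

(** Here n + 2, the third largest entry, was placed first and the whole budget
    is spent.  Placing n + 4 wins back 1 and leads to the situation of
    [orderings_skip_second]; placing n + 3 costs nothing and leaves n + 4 two
    ahead of its target. *)
Lemma orderings_skip_third n :
  orderings 0 [:: n.+4, n.+3 & countdown n.+1]
  = feasible n.+1 + orderings 1 [:: n.+3, n.+1 & countdown n].
Proof.
rewrite (@orderings_cat_countdown 0 [:: n.+4; n.+3] n.+1) //=; first last.
- by rewrite andbT; lia.
- by rewrite inE; lia.
rewrite big_mkcond !big_cons big_nil /= !eqxx addn0 addnC.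
rewrite (_ : (n.+4 == n.+3) = false); last lia.
rewrite !ifT /=; [ | lia | lia].
rewrite -(orderings_two_ahead n.+1) countdownS.
by congr (orderings _ _ + orderings _ _); lia.
Qed.

Lemma feasible_rec n :
  feasible n.+4
  = feasible n.+3 + feasible n.+2 + 3 * feasible n.+1 + feasible n.
Proof.
by rewrite feasible_first orderings_skip_third !orderings_skip_second; lia.
Qed.

Section TypeC.
Local Open Scope ring_scope.

(** * Permutations and orderings *)

(** The entries of v are distinct, so a permutation can be read off from the
    list of reordered coordinates. *)
Lemma card_perm_within_budget b (v : seq nat) (r : nat) :
    size v = r -> uniq v ->
  #|[set s : 'S_r | within_budget b [seq nth 0%N v (s i) | i <- enum 'I_r]]|
  = orderings b v.
Proof.
move=> szv uv; pose f (s : 'S_r) := [seq nth 0%N v (s i) | i <- enum 'I_r].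
have f_nth (s : 'S_r) (i : 'I_r) : nth 0%N (f s) i = nth 0%N v (s i).
  by rewrite (nth_map i) ?size_enum_ord // nth_ord_enum.
have f_inj : injective f.
  move=> s s' ff; apply/permP => i; apply/val_inj/eqP.
  rewrite -(nth_uniq 0%N _ _ uv) ?szv ?ltn_ord //; apply/eqP.
  by have := f_nth s i; rewrite ff f_nth.
have perm_f : perm_eq (map f (index_enum 'S_r)) (permutations v).
  apply: uniq_perm => [||t].
  - by rewrite map_inj_uniq // index_enum_uniq.
  - exact: permutations_uniq.
  have szvE : size v == r by apply/eqP.
  have ftuple (s : 'S_r) : f s = [tuple tnth (Tuple szvE) (s i) | i < r].
    by apply: eq_map => i; rewrite (tnth_nth 0%N).
  rewrite mem_permutations; apply/mapP/(@tuple_permP _ _ _ (Tuple szvE)).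
    by move=> [s _ ->]; exists s.
  by move=> [s ->]; exists s; rewrite ?mem_index_enum.
rewrite /orderings -(seq.permP perm_f) count_map -sum1_count -sum1_card.
by apply: eq_bigl => s; rewrite inE.
Qed.

(** * The highest root and rho *)

Lemma eps_out r : eps r r = 0.
Proof. by apply/colP => i; rewrite !mxE ltn_eqF. Qed.

(** As [eps r r] vanishes, every term, the last included, has the form
    2 ([eps r i] - [eps r i.+1]), so the sum telescopes. *)
Lemma highest_rootE r : highest_root r.+1 = 2 *: eps r.+1 0.
Proof.
rewrite /highest_root (eq_bigr (fun i : 'I_r.+1 =>
    2 *: eps r.+1 i - 2 *: eps r.+1 i.+1)); last first.
  move=> i _; rewrite /simple_root; case: eqP => [->|_].
    by rewrite eps_out scale1r scaler0 subr0.
  by rewrite scalerBr.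
rewrite -(big_mkord xpredT (fun i => 2 *: eps r.+1 i - 2 *: eps r.+1 i.+1)).
apply: oppr_inj; rewrite -sumrN.
under eq_bigr do rewrite opprB.
by rewrite telescope_sumr // eps_out scaler0 sub0r.
Qed.

Lemma uniq_root_pairs r (f : 'I_r -> 'I_r -> 'cV[rat]_r) :
    (forall i j i' j' : 'I_r, (i < j)%N -> (i' < j')%N ->
       f i j = f i' j' -> i = i' /\ j = j') ->
  uniq [seq f i j | i : 'I_r <- enum 'I_r,
                    j : 'I_r <- [seq j : 'I_r <- enum 'I_r | (i < j)%N]].
Proof.
move=> f_inj; apply: allpairs_uniq_dep => [|i _|]; [exact: enum_uniq| |].
  by rewrite filter_uniq ?enum_uniq.
set st := (X in {in X &, _}).
have lt_st p : p \in st -> ((tag p : 'I_r) < (tagged p : 'I_r))%N.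
  move=> /allpairsPdep[i [j [_]]]; rewrite mem_filter => /andP[ij _] ->.
  exact: ij.
move=> [i j] [i' j'] /lt_st /= ij /lt_st /= ij' /(f_inj _ _ _ _ ij ij')[-> ->].
by [].
Qed.

(** The sum defining rho runs over a type without repetitions; this allows it to
    be computed along the list [pos_roots]. *)
Lemma uniq_pos_roots r : uniq (pos_roots r).
Proof.
have eval (v v' : 'cV[rat]_r) (k : 'I_r) : v = v' -> v k 0 = v' k 0 by move=> ->.
have ordE (i j : 'I_r) : i = j :> nat -> i = j by exact: val_inj.
rewrite !cat_uniq !uniq_root_pairs ?map_inj_uniq ?enum_uniq //=.
- apply/and3P; split; [| |by rewrite -enumT enum_uniq]; apply/hasPn => v.
    rewrite mem_cat => vE; apply/allpairsPdep => -[i [j [_]]].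
    rewrite mem_filter => /andP[ij _] vij; suff : 0 <= v j 0.
      by rewrite vij !mxE eqxx gtn_eqF.
    case/orP: vE => [/allpairsPdep[i' [j' [_ _ ->]]]|/mapP[i' _ ->]].
      by rewrite !mxE addr_ge0 ?ler0n.
    by rewrite !mxE mulr_ge0 ?ler0n.
  move=> /mapP[i' _ ->]; apply/allpairsPdep => -[i [j [_]]].
  rewrite mem_filter => /andP[ij _] /(eval _ _ i); rewrite !mxE eqxx (ltn_eqF ij).
  by case: eqP => _ /=; lra.
- move=> i i' E; have {E} := eval _ _ i E; rewrite !mxE eqxx.
  case: eqVneq => [/ordE -> //|_] /= H.
  by exfalso; lra.
(* Sums and differences alike: the coordinates i and j of the root
   determine the pair, once i < j fixes the order of its entries. *)
all: move=> i j i' j' ij ij' E.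
all: have Ei := eval _ _ i E; have {E} := eval _ _ j E; move: Ei.
all: rewrite !mxE !eqxx (gtn_eqF ij) (ltn_eqF ij).
all: case: (eqVneq (i : nat) i') => [ii|ii]; case: (eqVneq (j : nat) j') => [jj|jj] /=.
all: case: (eqVneq (i : nat) j') => [ij1|ij1].
all: case: (eqVneq (j : nat) i') => [ji|ji] /=.
all: move=> Ei Ej.
all: by [split; apply: ordE | exfalso; lia | exfalso; lra].
Qed.

(** The differences and the sums indexed by i < j add up to 2 [eps r i], so i
    contributes r - i - 1 such terms and one more from the long root. *)
Lemma rhoE r : rho r = \col_(i < r) (r - i)%:R.
Proof.
have sum_sub (F : 'cV[rat]_r -> 'cV[rat]_r) :
    \sum_(a : pos_root r) F (ssval a) = \sum_(v <- pos_roots r) F v.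
  rewrite -(big_map (@ssval _ _) xpredT F); apply: perm_big; apply: uniq_perm.
  - by rewrite map_inj_uniq ?index_enum_uniq //; exact: val_inj.
  - exact: uniq_pos_roots.
  move=> v; apply/mapP/idP => [[a _ ->]|vP]; first exact: ssvalP.
  by exists (SeqSub vP); rewrite ?mem_index_enum.
rewrite /rho (sum_sub id) /pos_roots !big_cat /= !big_allpairs_dep big_map !big_enum /=.
rewrite addrA -big_split -big_split /=.
rewrite (eq_bigr (fun i : 'I_r => (2 * (r - i)%:R) *: eps r i)); last first.
  move=> i _; rewrite !big_filter !big_enum_cond /= -big_split /=.
  rewrite (eq_bigr (fun=> (2 *: eps r i) *+ 1)); last first.
    by move=> j _; rewrite addrACA addNr addr0 scaler_nat.
  have above : (\sum_(j < r | i < j) 1 = r - i.+1)%N.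
    by have := sum_nat_const_nat i.+1 r 1; rewrite big_geq_mkord muln1.
  by rewrite sumrMnr above -mulrSr subnSK // -scaler_nat scalerA mulrC.
rewrite scaler_sumr; apply/colP => k; rewrite summxE (bigD1 k) //= big1 => [|i ik].
  by rewrite addr0 !mxE eqxx mulr1 mulKf.
by rewrite !mxE eq_sym (negbTE ik : (i : nat) == k = false) !mulr0.
Qed.

(** * Positivity of the partition function *)

Lemma kostant_gt0P r (xi : 'cV[rat]_r) :
  (0 < kostant xi)%N <-> exists m, root_decomp xi m.
Proof.
rewrite /kostant cardfs_gt0; split.
  by move=> /fset0Pn[m]; rewrite in_fset_set ?inE; [exists m|exact: finite_root_decomp].
move=> [m mxi]; apply/fset0Pn; exists m.
by rewrite in_fset_set ?inE //; exact: finite_root_decomp.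
Qed.

Lemma colB r (u v : 'cV[rat]_r) i : (u - v) i 0 = u i 0 - v i 0.
Proof. by rewrite !mxE. Qed.

(** The sum of the first k coordinates is the pairing with a fundamental weight,
    which is nonnegative on every positive root. *)
Lemma kostant_partial_sum r (xi : 'cV[rat]_r) k :
  (0 < kostant xi)%N -> 0 <= \sum_(i < r | (i < k)%N) xi i 0.
Proof.
move=> /kostant_gt0P[m <-].
under eq_bigr do rewrite summxE.
rewrite exchange_big sumr_ge0 // => a _.
under eq_bigr do rewrite mulmxnE.
rewrite sumrMnl mulrn_wge0 //.
have sum_eps (i : 'I_r) : \sum_(p < r | (p < k)%N) eps r i p 0 = (i < k)%N%:R.
  rewrite big_mkcond (bigD1 i) //= mxE eqxx big1 ?addr0; first by case: ifP.
  move=> p pi; rewrite mxE (negbTE pi : (p : nat) == i = false).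
  by case: ifP.
have := ssvalP a; rewrite !mem_cat => /or3P[/allpairsPdep|/allpairsPdep|/mapP].
- move=> [i [j [_]]]; rewrite mem_filter => /andP[ij _] ->.
  under eq_bigr do rewrite colB.
  by rewrite sumrB !sum_eps subr_ge0 ler_nat; case: (ltnP j k); lia.
- move=> [i [j [_ _ ->]]]; under eq_bigr do rewrite mxE.
  by rewrite big_split /= !sum_eps addr_ge0.
- move=> [i _ ->]; under eq_bigr do rewrite mxE.
  by rewrite -mulr_sumr sum_eps mulr_ge0.
Qed.

Lemma kostantD r (x y : 'cV[rat]_r) :
  (0 < kostant x)%N -> (0 < kostant y)%N -> (0 < kostant (x + y))%N.
Proof.
move=> /kostant_gt0P[m mx] /kostant_gt0P[n ny]; apply/kostant_gt0P.
exists [ffun a => (m a + n a)%N]; rewrite /root_decomp /= -mx -ny -big_split.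
by apply: eq_bigr => a _; rewrite ffunE mulrnDr.
Qed.

Lemma kostant0 r : (0 < kostant (0 : 'cV[rat]_r))%N.
Proof.
apply/kostant_gt0P; exists [ffun=> 0%N]; rewrite /root_decomp /=.
by rewrite big1 // => a _; rewrite ffunE.
Qed.

Lemma kostant_pos_root r (a : pos_root r) : (0 < kostant (ssval a))%N.
Proof.
apply/kostant_gt0P; exists [ffun b => (b == a : nat)]; rewrite /root_decomp /=.
rewrite (bigD1 a) //= ffunE eqxx big1 ?addr0 // => b ba.
by rewrite ffunE (negbTE ba).
Qed.

Lemma simple_root_pos r (i : 'I_r) : simple_root i \in pos_roots r.
Proof.
rewrite /simple_root !mem_cat; case: ifP => ir.
  by apply/or3P/Or33/mapP; exists i; rewrite ?mem_enum.
have i1r : (i.+1 < r)%N by have := ltn_ord i; lia.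
apply/or3P/Or31/allpairsPdep; exists i, (Ordinal i1r).
by split; rewrite ?mem_enum // mem_filter mem_enum /= andbT.
Qed.

Lemma kostant_simple_sum r (c : 'I_r -> nat) :
  (0 < kostant (\sum_i simple_root i *+ c i))%N.
Proof.
elim/big_ind: _ => [|x y|i _]; [exact: kostant0|exact: kostantD|].
elim: (c i) => [|n IHn]; first exact: kostant0.
rewrite mulrS; apply: kostantD => //.
exact: (kostant_pos_root (SeqSub (simple_root_pos i))).
Qed.

(** Abel summation: the partial sums are the coefficients of xi on the simple
    roots, except that the long root takes half of the last one. *)
Lemma kostant_gt0_of_partial_sums r (xi : 'cV[rat]_r) (c : nat -> nat) :
    (forall k, (k <= r)%N -> \sum_(i < r | (i < k)%N) xi i 0 = (c k)%:R) ->
  ~~ odd (c r) -> (0 < kostant xi)%N.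
Proof.
move=> cE c_even.
suff -> : xi = \sum_(i < r)
    simple_root i *+ (if i.+1 == r then (c r)./2 else c i.+1).
  exact: kostant_simple_sum.
rewrite (eq_bigr (fun i : 'I_r => eps r i *+ c i.+1 - eps r i.+1 *+ c i.+1)).
  (* The half of the last partial sum is the coefficient of the long root. *)
  2: move=> i _; rewrite /simple_root; case: eqP => [->|_]; last by rewrite mulrnBl.
  2: rewrite eps_out mul0rn subr0 scaler_nat -mulrnA; congr (_ *+ _).
  2: by rewrite mul2n halfK (negbTE c_even) subn0.
have c0 : c 0%N = 0%N.
  by apply/eqP; rewrite -(eqr_nat rat) -cE // big_pred0.
apply/colP => k; rewrite summxE.
under eq_bigr do rewrite colB !mulmxnE.
rewrite sumrB (bigD1 k) //= mxE eqxx big1 ?addr0; last first.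
  by move=> p pk; rewrite mxE eq_sym (negbTE pk : (p : nat) == k = false) mul0rn.
have -> : \sum_(i < r) eps r i.+1 k 0 *+ c i.+1 = (c k)%:R.
  have [k0|k0] := posnP k.
    by rewrite k0 c0 big1 // => i _; rewrite mxE k0 mul0rn.
  have k1r : (k.-1 < r)%N by have := ltn_ord k; lia.
  rewrite (bigD1 (Ordinal k1r)) //= prednK // mxE eqxx big1 ?addr0 // => p.
  rewrite mxE -val_eqE /= => pk; rewrite (_ : (k : nat) == p.+1 = false) ?mul0rn //.
  by lia.
have ckS : true%:R *+ c k.+1 = \sum_(i < r | (i < k.+1)%N) xi i 0.
  by rewrite cE.
rewrite ckS -(cE k (ltnW (ltn_ord k))) (bigD1 k (ltnSn k)) /= -addrA.
rewrite (eq_bigl (fun i : 'I_r => (i < k)%N)); first by rewrite subrr addr0.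
by move=> i; rewrite -val_eqE /=; lia.
Qed.

(** Subtracting rho = (r, ..., 1) means comparing the entries of t with the
    targets, and the budget condition says that the partial sums of the
    difference are nonnegative.  The total of the difference is even, which makes
    the coefficient of the long root an integer. *)
Lemma kostant_within_budget r (t : seq nat) d :
    size t = r ->
    (\sum_(i < r) nth 0 t i = d.*2 + \sum_(i < r) (r - i))%N ->
  (0 < kostant (\col_(i < r) (nth 0%N t i)%:R - rho r))%N = within_budget 0 t.
Proof.
move=> szt sumt; set xi := _ - _.
have xiE k : (k <= r)%N -> \sum_(i < r | (i < k)%N) xi i 0
    = (\sum_(i < k) nth 0%N t i)%:R - (\sum_(i < k) (r - i))%:R.
  move=> kr; under eq_bigr do rewrite /xi rhoE colB 2!mxE.
  rewrite sumrB !natr_sum (big_ord_widen r (fun i => (nth 0%N t i)%:R) kr).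
  by rewrite (big_ord_widen r (fun i => (r - i)%:R) kr).
have := within_budgetP 0 t; rewrite szt => within_budget0P.
apply/idP/within_budget0P => [xi_pos k kr|t_ge].
  by have := kostant_partial_sum k xi_pos; rewrite xiE // subr_ge0 ler_nat add0n.
apply: (@kostant_gt0_of_partial_sums _ _
  (fun k => \sum_(i < k) nth 0%N t i - \sum_(i < k) (r - i))%N) => [k kr|].
  by rewrite xiE // natrB //; have := t_ge k kr; rewrite add0n.
by rewrite sumt addnK odd_double.
Qed.

(** * Weyl group elements without the last factor *)

(** The permutation of the coordinates underlying a simple reflection: the
    last reflection only changes a sign, hence the identity. *)
Definition refl_perm r (i : 'I_r) : 'S_r :=
  if insub i.+1 is Some j then tperm i j else 1%g.

Lemma refl_perm_last r (i : 'I_r) : i.+1 = r -> refl_perm i = 1%g.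
Proof. by move=> ir; rewrite /refl_perm insubF // ir ltnn. Qed.

Lemma epsTM r n (k : 'I_r) (B : 'M[rat]_(r, n)) : (eps r k)^T *m B = row k B.
Proof.
apply/rowP => j; rewrite !mxE (bigD1 k) //= !mxE eqxx mul1r big1 ?addr0 // => l lk.
by rewrite !mxE (negbTE lk : (l : nat) == k = false) mul0r.
Qed.

Lemma reflectionM r n (a : 'cV[rat]_r) (A : 'M_(r, n)) :
  reflection a *m A = A - (2 / (a^T *m a) 0 0) *: (a *m (a^T *m A)).
Proof. by rewrite /reflection mulmxBl mul1mx -scalemxAl mulmxA. Qed.

Lemma simple_refl_lastM r n (i p : 'I_r) (j : 'I_n) (A : 'M_(r, n)) :
  i.+1 = r -> (simple_refl i *m A) p j = (-1) ^+ (p == i) * A p j.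
Proof.
move=> ir; rewrite /simple_refl /simple_root ir eqxx reflectionM.
rewrite [(2 *: _)^T]linearZ /= -!scalemxAl !epsTM !mxE !big_ord1 !mxE.
rewrite eqxx (_ : ((p : nat) == i) = (p == i)) //.
by case: eqVneq => [->|_] /=; field.
Qed.

Lemma simple_refl_perm r (i : 'I_r) :
  i.+1 != r -> simple_refl i = perm_mx (refl_perm i).
Proof.
move=> ir; have i1r : (i.+1 < r)%N by rewrite ltn_neqAle ir ltn_ord.
have [k kE] : exists k : 'I_r, k = i.+1 :> nat by exists (Ordinal i1r).
have -> : refl_perm i = tperm i k.
  by rewrite /refl_perm insubT; congr tperm; apply: val_inj; rewrite /= kE.
rewrite -[LHS]mulmx1 -[RHS]mulmx1 -row_permE.
apply/matrixP => p j; rewrite /simple_refl /simple_root (negbTE ir) reflectionM.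
rewrite -kE [(_ - _)^T]linearB /= !mulmxBl !epsTM !mxE !big_ord1 !mxE.
have ki : (k == i) = false by apply/negbTE/eqP => /(congr1 val) /=; lia.
have natE (u v : 'I_r) : ((u : nat) == v) = (u == v) by [].
rewrite !natE !eqxx !(eq_sym i k) !ki.
case: tpermP => [->|->|/eqP/negbTE pi /eqP/negbTE pk].
- by rewrite !eqxx !(eq_sym i k) !ki /=; field.
- by rewrite !eqxx !ki /=; field.
by rewrite pi pk /=; field.
Qed.

Definition word_perm r (w : seq 'I_r) : 'S_r := (\prod_(i <- w) refl_perm i)%g.

Lemma word_prod_cons r i (w : seq 'I_r) :
  word_prod (i :: w) = simple_refl i *m word_prod w.
Proof. by rewrite /word_prod big_cons. Qed.

Lemma word_prod_cat r (w1 w2 : seq 'I_r) :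
  word_prod (w1 ++ w2) = word_prod w1 *m word_prod w2.
Proof.
elim: w1 => [|i w1 IHw1]; first by rewrite /word_prod big_nil mul1mx.
by rewrite cat_cons !word_prod_cons IHw1 mulmxA.
Qed.

Lemma norm_perm_mx r (s : 'S_r) :
  map_mx Num.norm (perm_mx s) = perm_mx s :> 'M[rat]_r.
Proof. by apply/matrixP => i j; rewrite !mxE normr_nat. Qed.

(** Forgetting the signs is a homomorphism from signed permutations to
    permutations, and it kills the last reflection. *)
Lemma norm_word_prod r (w : seq 'I_r) :
  map_mx Num.norm (word_prod w) = perm_mx (word_perm w).
Proof.
elim: w => [|i w IHw].
  by rewrite /word_prod /word_perm !big_nil -perm_mx1 norm_perm_mx.
rewrite word_prod_cons /word_perm big_cons perm_mxM -IHw.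
have [ir|ir] := eqVneq i.+1 r.
  rewrite refl_perm_last // perm_mx1 mul1mx.
  apply/matrixP => p j; rewrite [LHS]mxE simple_refl_lastM // [RHS]mxE.
  by rewrite normrM normrX normrN1 expr1n mul1r.
rewrite simple_refl_perm // -!row_permE.
by apply/matrixP => p j; rewrite !mxE.
Qed.

Lemma word_prod_perm r (w : seq 'I_r) :
  all (fun i : 'I_r => i.+1 != r) w -> word_prod w = perm_mx (word_perm w).
Proof.
elim: w => [_|i w IHw /= /andP[ir /IHw wE]].
  by rewrite /word_prod /word_perm !big_nil perm_mx1.
by rewrite word_prod_cons wE /word_perm big_cons perm_mxM simple_refl_perm.
Qed.

Lemma word_perm_drop_last r (w : seq 'I_r) :
  word_perm [seq i : 'I_r <- w | i.+1 != r] = word_perm w.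
Proof.
rewrite /word_perm big_filter big_mkcond /=; apply: eq_bigr => i _.
by case: eqP => //= /refl_perm_last ->.
Qed.

(** Adjacent transpositions generate the symmetric group; an arbitrary
    transposition is reached by conjugation, one step of distance at a time. *)
Lemma perm_mx_word r (s : 'S_r) : exists w : seq 'I_r, word_prod w = perm_mx s.
Proof.
have mulW s1 s2 : weyl_group r (perm_mx s1) -> weyl_group r (perm_mx s2) ->
    weyl_group r (perm_mx (s1 * s2)).
  move=> [w1 w1E] [w2 w2E]; exists (w1 ++ w2).
  by rewrite word_prod_cat w1E w2E perm_mxM.
have adjW (x y : 'I_r) : y = x.+1 :> nat -> weyl_group r (perm_mx (tperm x y)).
  move=> yE; have xr : (x.+1 < r)%N by rewrite -yE.
  exists [:: x]; rewrite word_prod_cons /word_prod big_nil mulmx1.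
  rewrite simple_refl_perm ?ltn_eqF //.
  rewrite /refl_perm insubT; congr (perm_mx (tperm x _)).
  by apply: val_inj; rewrite /= yE.
have tpermW d : forall x y : 'I_r, y = (x + d).+1 :> nat ->
    weyl_group r (perm_mx (tperm x y)).
  elim: d => [|d IHd] x y yE; first by apply: adjW; rewrite yE addn0.
  have x1r : (x.+1 < r)%N by have := ltn_ord y; lia.
  pose x1 := Ordinal x1r.
  have <- : (tperm x x1 ^ tperm x1 y)%g = tperm x y.
    by rewrite tpermJ tpermL tpermD // -val_eqE /=; lia.
  have x1W : weyl_group r (perm_mx (tperm x1 y)).
    by apply: IHd; rewrite yE /=; lia.
  by rewrite /conjg tpermV; do 2![apply: (mulW) => //]; exact: adjW.
have [ts -> _] := prod_tpermP s.
elim: ts => [|[x y] ts IHts].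
  by exists [::]; rewrite big_nil perm_mx1 /word_prod big_nil.
rewrite big_cons; apply: mulW => //=.
wlog xy : x y / (x <= y)%N.
  by move=> H; case/orP: (leq_total x y) => /H //; rewrite tpermC.
have [->|nxy] := eqVneq x y.
  by rewrite tperm1 perm_mx1; exists [::]; rewrite /word_prod big_nil.
by apply: (tpermW (y - x).-1); move: nxy; rewrite -val_eqE /=; lia.
Qed.

(** Deleting the last reflections from a word for a permutation matrix leaves
    its product unchanged, as both words have the same underlying permutation
    and neither product has a negative entry; so a reduced word for a
    permutation matrix never contains the last reflection.  Conversely, the
    other simple reflections are permutation matrices. *)
Lemma no_last_factorP r (sigma : 'M[rat]_r) :
  weyl_group r sigma /\ ~ has_last_factor sigma <->
  exists s : 'S_r, sigma = perm_mx s.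
Proof.
split=> [[[w0 w0E] nolast]|[s ->]].
  pose word_length n :=
    `[< exists w : seq 'I_r, size w = n /\ word_prod w = sigma >].
  have exn : exists n, word_length n by exists (size w0); apply/asboolP; exists w0.
  have [n /asboolP[w [szw wE]] n_min] := ex_minnP exn.
  exists (word_perm w); rewrite -wE word_prod_perm //; apply/allP => i iw.
  apply/negP => /eqP ir; apply: nolast; exists w; split; last by exists i.
  split=> // w' w'E; rewrite szw; apply: n_min; apply/asboolP.
  by exists w'.
split=> [|[w [[wE w_min] [i iw ir]]]]; first exact: perm_mx_word.
have := w_min [seq i : 'I_r <- w | i.+1 != r].
rewrite (word_prod_perm (filter_all _ _)) word_perm_drop_last -norm_word_prod.
rewrite wE norm_perm_mx => /(_ erefl); rewrite size_filter leqNgt.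
rewrite ltn_neqAle count_size -all_count andbT => /negPn/allP/(_ i iw).
by rewrite ir eqxx.
Qed.

(** * Counting *)

(** The coordinates r + 2, r - 1, ..., 1 of the highest root plus rho, for
    r = n + 1. *)
Definition top_coords (n : nat) : seq nat := n.+3 :: countdown n.

Lemma highest_root_rhoE n :
  highest_root n.+1 + rho n.+1 = \col_i (nth 0%N (top_coords n) i)%:R.
Proof.
rewrite highest_rootE rhoE; apply/colP => -[[|i] i_n]; rewrite !mxE /=.
  by rewrite mulr1 -natrD subn0 add2n.
by rewrite mulr0 add0r nth_countdown // subSS.
Qed.

Lemma kostant_perm n (s : 'S_n.+1) :
  (0 < kostant (perm_mx s *m (highest_root n.+1 + rho n.+1) - rho n.+1))%N
  = within_budget 0 [seq nth 0%N (top_coords n) (s i) | i <- enum 'I_n.+1].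
Proof.
set t := map _ _.
have t_nth (i : 'I_n.+1) : nth 0%N t i = nth 0%N (top_coords n) (s i).
  by rewrite (nth_map i) ?size_enum_ord // nth_ord_enum.
have szt : size t = n.+1 by rewrite size_map size_enum_ord.
rewrite -(@kostant_within_budget n.+1 t 1 szt); last first.
  under eq_bigr do rewrite t_nth.
  have -> : (\sum_(i < n.+1) nth 0 (top_coords n) (s i)
             = \sum_(i < n.+1) nth 0 (top_coords n) i)%N.
    by rewrite [RHS](reindex_inj (@perm_inj _ s)).
  rewrite !big_ord_recl subn0 /=.
  under eq_bigr => i _ do rewrite nth_countdown ?ltn_ord //.
  by rewrite [RHS]addnA; congr (_ + _)%N; apply: eq_bigr.
suff -> : perm_mx s *m (highest_root n.+1 + rho n.+1)
          = \col_i (nth 0%N t i)%:R by [].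
rewrite highest_root_rhoE -row_permE; apply/colP => i.
by rewrite !mxE t_nth.
Qed.

(** The condition at the first coordinate forces the entry r + 2 to come first,
    which leaves the budget 2 for ordering r - 1, ..., 1. *)
Lemma card_P_feasible n : card_P n.+2 = feasible n.+1.
Proof.
pose A := [set s : 'S_n.+2 |
  within_budget 0 [seq nth 0%N (top_coords n.+1) (s i) | i <- enum 'I_n.+2]]%SET.
have PE : P n.+2 = [set` [fset (perm_mx s : 'M[rat]_n.+2) | s in A]%fset]%classic.
  apply/seteqP; split=> sigma /=.
    move=> [[sigmaW sigma_pos] nolast].
    have [s sE] := (no_last_factorP sigma).1 (conj sigmaW nolast).
    by apply/imfsetP; exists s => //=; rewrite inE -kostant_perm -sE.
  move=> /imfsetP[s /=]; rewrite inE -kostant_perm => s_pos sigmaE.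
  have [sigmaW nolast] := (no_last_factorP sigma).2 (ex_intro _ s sigmaE).
  by rewrite /weyl_alt_set /= sigmaE in sigmaW nolast *.
rewrite /card_P PE set_fsetK card_imfset /=; last first.
  move=> s s' /matrixP ss; apply/permP => i; apply/eqP.
  by have := ss i (s i); rewrite !mxE eqxx; case: eqVneq => // ->.
rewrite -cardE card_perm_within_budget /top_coords; first exact: orderings_two_ahead.
  by rewrite /= size_countdown.
by rewrite /= uniq_countdown mem_countdown andbT; lia.
Qed.
End TypeC.

Theorem proposition5p10 :
  [/\ card_P 0 = 0, card_P 1 = 1, card_P 2 = 1, card_P 3 = 2 &
      forall r : nat, 4 <= r ->
        card_P r = card_P (r - 1) + card_P (r - 2)
                   + 3 * card_P (r - 3) + card_P (r - 4)].
Proof.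
have P0 : card_P 0 = 0 by rewrite /card_P fset_set0 cardfs0.
have P1 : card_P 1 = 1 by rewrite /card_P fset_set1 cardfs1.
have f1 : feasible 1 = 1 by [].
have f2 : feasible 2 = 2 by [].
have f3 : feasible 3 = 6 by [].
split; rewrite ?card_P_feasible //.
move=> [|[|[|[|[|[|r]]]]]] // _.
- by rewrite /= !card_P_feasible P0 P1 f1 f2 f3.
- by rewrite /= !card_P_feasible feasible_rec P1.
by rewrite !subSS !subn0 !card_P_feasible feasible_rec.
Qed.
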